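(* Let $E$ be a locally compact and second countable Hausdorff space, $\mathcal{E}$ be the corresponding Borel $\sigma$-field, and $\psi:E\to[0,\infty)$ be a continuous function satisfying $\psi\ge1$ outside some compact set. Let $\mathcal{P}$ be a class of probability measures on $(\Omega,\mathcal{F})=(E^{\mathbb{N}},\mathcal{E}^{\mathbb{N}})$ such that (a) $\mathbb{P}_1=\mathbb{P}_2=\cdots$ for all $\mathbb{P}\in\mathcal{P}$, (b) $\lim_{K\to\infty}\sup_{\mathbb{P}\in\mathcal{P}}\int\psi(y)\mathbf{1}_{\{\psi(y)\ge K\}}\,\mathbb{P}_1(dy)=0$, (c) $\lim_{n\to\infty}\sup_{\mathbb{P}\in\mathcal{P}}\alpha_{\mathbb{P}}(n)=0$. Then, for every $\delta>0$, $$\lim_{n\to\infty}\ \sup_{\mathbb{P}\in\mathcal{P}}\ \mathbb{P}\bigl[d_{\psi,\mathrm{vag}}(\widehat m_n,\mathbb{P}_1)\ge\delta\bigr]=0.$$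
   Context: Here $X_i$ is the $i$th coordinate projection on $\Omega:=E^{\mathbb{N}}$ (with product $\sigma$-field $\mathcal{F}:=\mathcal{E}^{\mathbb{N}}$), and $\mathbb{P}_i:=\mathbb{P}\circ X_i^{-1}$ is the $i$th marginal distribution of a probability measure $\mathbb{P}$ on $(\Omega,\mathcal{F})$. The empirical probability measure is $\widehat m_n(x):=\frac1n\sum_{i=1}^n\delta_{x_i}$ for $x=(x_1,x_2,\ldots)\in\Omega$. Let $\mathcal{M}_1^\psi(E)$ be the set of all probability measures $\mu$ on $(E,\mathcal{E})$ with $\int\psi\,d\mu<\infty$. Let $\{f_k\}_{k\in\mathbb{N}}$ be a fixed countable subset, dense with respect to the supremum norm, of the space $C_{\mathsf c}(E)$ of all continuous real functions on $E$ with compact support. For $\mu,\nu\in\mathcal{M}_1^\psi(E)$ set $$d_{\mathrm{vag}}(\mu,\nu):=\sum_{k=1}^\infty\frac1{2^k}\Bigl\{1\wedge\Bigl|\int f_k\,d\mu-\int f_k\,d\nu\Bigr|\Bigr\}$$ (this metrizes the vague topology on $\mathcal{M}_1^\psi(E)$) and $$d_{\psi,\mathrm{vag}}(\mu,\nu):=d_{\mathrm{vag}}(\mu,\nu)+\Bigl|\int\psi\,d\mu-\int\psi\,d\nu\Bigr|.$$ The $n$th strong mixing coefficient of the coordinate process under $\mathbb{P}$ is $\alpha_{\mathbb{P}}(n):=\sup_{k\ge1}\sup_{A,B}|\mathbb{P}[A\cap B]-\mathbb{P}[A]\mathbb{P}[B]|$, where the inner supremum ranges over all $A\in\sigma(X_1,\ldots,X_k)$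 and $B\in\sigma(X_{k+n},X_{k+n+1},\ldots)$. *)

(* Defs.v *)
From HB Require Import structures.
From mathcomp Require Import all_boot all_order all_algebra.
From mathcomp Require Import all_classical all_reals all_analysis.
From mathcomp Require Import measurable_realfun.

Set Implicit Arguments.
Unset Strict Implicit.
Unset Printing Implicit Defensive.

Import Order.TTheory GRing.Theory Num.Theory.
Import numFieldNormedType.Exports.

Local Open Scope classical_set_scope.
Local Open Scope ring_scope.

Definition borel (E : ptopologicalType) := g_sigma_algebraType (@open E).

Definition coord_preimages (E : ptopologicalType) (J : set nat) :
    set (set (nat -> E)) :=
  \bigcup_(i in J)
    preimage_set_system setT (fun x : nat -> E => x i : borel E) measurable.

(* E^N with the product sigma-field. Sequences are indexed from 0, so that
   the projection called X_i (i >= 1) in the literature is [coord i.-1]. *)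
Definition pathspace (E : ptopologicalType) :=
  g_sigma_algebraType (@coord_preimages E setT).

Definition coord (E : ptopologicalType) (i : nat) : pathspace E -> borel E :=
  fun x => x i.

Lemma measurable_coord (E : ptopologicalType) (i : nat) :
  measurable_fun setT (@coord E i).
Proof.
move=> _ A mA; apply: sub_sigma_algebra; exists i => //.
by exists A.
Qed.

HB.instance Definition _ (E : ptopologicalType) (i : nat) :=
  isMeasurableFun.Build _ _ _ _ (@coord E i) (@measurable_coord E i).

Section Defs.
Context {R : realType} {E : ptopologicalType}.

Definition marginal (P : probability (pathspace E) R) (i : nat) :
    probability (borel E) R :=
  distribution P (@coord E i).

Definition coord_sigma (J : set nat) : set (set (pathspace E)) :=
  <<s coord_preimages J >>.

(* [coord i] is X_(i+1): the index sets are {X_1, ..., X_k} and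
   {X_(k+n), X_(k+n+1), ...}. *)
Definition strong_mixing (P : probability (pathspace E) R) (n : nat) : \bar R :=
  ereal_sup [set
    ereal_sup [set `|P (A `&` B) - P A * P B|%E |
      A in coord_sigma [set i | (i.+1 <= k)%N] &
      B in coord_sigma [set i | (k + n <= i.+1)%N]]
    | k in [set k | (1 <= k)%N]].

(* The zero measure when n = 0. *)
Definition empirical (n : nat) (x : pathspace E) :
    {measure set (borel E) -> \bar R} :=
  mscale (n%:R^-1)%:nng (msum (fun i => \d_(coord i x)) n).

Definition Cc : set (E -> R) :=
  [set f | continuous f /\ compact (closure [set x | f x != 0])].

Definition sup_norm (f : E -> R) : \bar R := ereal_sup [set `|f x|%:E | x in setT].

Definition dense_sequence_in_Cc (f : nat -> E -> R) :=
  (forall k, Cc (f k)) /\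
  forall g, Cc g -> forall e : R, 0 < e ->
    exists k, (sup_norm (fun x => (g x - f k x)%R) < e%:E)%E.

Definition M1psi (psi : E -> R) : set {measure set (borel E) -> \bar R} :=
  [set mu : {measure set (borel E) -> \bar R} |
    mu setT = 1%E /\ (\int[mu]_x (psi x)%:E < +oo)%E].

Definition d_vag (f : nat -> E -> R)
    (mu nu : {measure set (borel E) -> \bar R}) : R :=
  limn (series (fun k =>
    2 ^- k.+1 * Num.min 1 `|\int[mu]_x f k x - \int[nu]_x f k x|)).

(* A distance on [M1psi psi] only: outside of it [Rintegral] may return 0 for
   an infinite integral. [empirical_M1psi] and [marginal_M1psi] below show that
   empirical measures (n > 0) and uniformly integrable marginals belong to it. *)
Definition d_psi_vag (psi : E -> R) (f : nat -> E -> R)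
    (mu nu : {measure set (borel E) -> \bar R}) : R :=
  d_vag f mu nu + `|\int[mu]_x psi x - \int[nu]_x psi x|.

Lemma continuous_measurable_borel (psi : E -> R) :
  continuous psi -> measurable_fun (setT : set (borel E)) psi.
Proof.
move=> /continuousP cpsi.
apply: (measurability _ (RGenOInfty.measurableE R)) => _ [_ [a ->] <-].
rewrite setTI; apply: sub_sigma_algebra; apply: cpsi.
exact: interval_open.
Qed.

Lemma empirical_M1psi (psi : E -> R) (n : nat) (x : pathspace E) :
  continuous psi -> (forall y, 0 <= psi y) ->
  M1psi psi (empirical n.+1 x).
Proof.
move=> cpsi psi0; have mpsi := continuous_measurable_borel cpsi.
have mpsiE : measurable_fun (setT : set (borel E)) (EFin \o psi).
  exact/measurable_EFinP.
split.
  rewrite /empirical/= /mscale/= /msum/=.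
  under eq_bigr do rewrite diracT.
  by rewrite sumEFin -EFinM sumr_const card_ord mulVf// pnatr_eq0.
rewrite /empirical ge0_integral_mscale//=; last first.
  by move=> y _; rewrite lee_fin.
rewrite ge0_integral_measure_sum//; last by move=> y _; rewrite lee_fin.
under eq_bigr do rewrite integral_dirac// diracT mul1e.
by rewrite /= sumEFin -EFinM ltry.
Qed.

Lemma marginal_M1psi (psi : E -> R) (P : probability (pathspace E) R) (K : R) :
  continuous psi -> (forall y, 0 <= psi y) ->
  (\int[marginal P 0]_y (psi y * \1_[set z | K <= psi z] y)%:E < +oo)%E ->
  M1psi psi (marginal P 0).
Proof.
move=> cpsi psi0 fin; have mpsi := continuous_measurable_borel cpsi.
have mK : measurable ([set z | K <= psi z] : set (borel E)).
  by rewrite -[X in measurable X]setTI; apply: measurable_fun_le.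
have mI : measurable_fun (setT : set (borel E))
    (fun y => (psi y * \1_[set z | K <= psi z] y)%:E).
  by apply/measurable_EFinP; apply: measurable_funM.
have I0 y : (0 <= (psi y * \1_[set z | K <= psi z] y)%:E)%E.
  by rewrite lee_fin mulr_ge0.
have P1 : marginal P 0 setT = 1%E by exact: probability_setT.
split=> //.
have le1 : (\int[marginal P 0]_y (psi y)%:E <=
   \int[marginal P 0]_y (`|K|%:E + (psi y * \1_[set z | (K <= psi z)%R] y)%:E))%E.
  apply: ge0_le_integral => //.
  - by move=> y _; rewrite lee_fin.
  - exact/measurable_EFinP.
  - exact: emeasurable_funD.
  move=> y _; rewrite -EFinD lee_fin indicE.
  case: (leP K (psi y)) => Ky.
    by rewrite mem_set//= mulr1 lerDr.
  by rewrite memNset/= ?mulr0 ?addr0; [exact: le_trans (ltW Ky) (ler_norm _)|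
    apply/negP; rewrite -ltNge].
apply: le_lt_trans le1 _; rewrite ge0_integralD//.
by rewrite integral_cst// [X in (_ * X)%E]P1 mule1 lte_add_pinfty// ltry.
Qed.

End Defs.

(* Main.v *)
Require Import Defs.
From HB Require Import structures.
From mathcomp Require Import all_boot all_order all_algebra.
From mathcomp Require Import all_classical all_reals all_analysis.
From mathcomp Require Import measurable_realfun ring lra zify.
Import Order.TTheory GRing.Theory Num.Theory.
Import numFieldNormedType.Exports.
Local Open Scope classical_set_scope.
Local Open Scope ring_scope.
Set Implicit Arguments.
Unset Strict Implicit.
Unset Printing Implicit Defensive.

(* The proof gives more: the expectation of d_(psi,vag)(m_n, P_1) tends to 0
   uniformly over the class, and the theorem follows by Markov's inequality.
   For a function g write D_n(g) for the difference between the empirical mean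
   and the P_1-mean of g. If g is an indicator, the variance of D_n(g) is at
   most 1/n^2 times a sum of mixing coefficients at distances |i - j|, hence
   E|D_n(g)| -> 0 uniformly. Since E|D_n(g)| <= 2 int |g| dP_1 by stationarity
   of the marginals, the class of functions with this uniform L^1 law of large
   numbers is closed under uniform L^1(P_1) approximation. It therefore contains
   every nonnegative uniformly integrable function, such as psi, and every
   bounded one, such as the f_k. The tail of the series d_vag beyond N is at
   most 2^-N. *)

(** * Null limits in the extended reals, and the triangle inequality in L^1 *)

Lemma cvge0_lt (R : realType) (T : Type) (F : set_system T) (FF : Filter F)
    (u : T -> \bar R) :
  u x @[x --> F] --> 0%E ->
  forall e : R, 0 < e -> \forall x \near F, (`|u x| < e%:E)%E.
Proof.
move=> /fine_cvgP[ufin /cvgr0Pnorm_lt u0] e e0.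
near=> x.
have /fineK <- : u x \is a fin_num by near: x.
by rewrite abse_EFin lte_fin; near: x; exact: u0.
Unshelve. all: by end_near. Qed.

Lemma cvge0_near (R : realType) (u : nat -> \bar R) :
  (\forall n \near \oo, 0 <= u n)%E ->
  (forall e : R, 0 < e -> \forall n \near \oo, (u n <= e%:E)%E) ->
  u n @[n --> \oo] --> 0%E.
Proof.
move=> u0 ule.
(* The upper bound by a real also supplies the finiteness that convergence of the real parts
   requires. *)
have ufin (e : R) : 0 < e ->
    \forall n \near \oo, u n \is a fin_num /\ `|fine (u n)| <= e.
  move=> e0; move: (ule _ e0) u0; apply: filterS2 => n une un0.
  have fu : u n \is a fin_num by rewrite ge0_fin_numE// (le_lt_trans une) ?ltry.
  by split=> //; rewrite ger0_norm ?fine_ge0// -lee_fin fineK.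
apply/fine_cvgP; split.
  by apply: filterS (ufin _ ltr01) => n [].
apply/cvgr0Pnorm_lt => e e0.
have e20 : 0 < e / 2 by rewrite divr_gt0.
apply: filterS (ufin _ e20) => n [_] /le_lt_trans; apply.
by rewrite ltr_pdivrMr// ltr_pMr// ltr1n.
Qed.

Lemma integral_normD_le d (T : measurableType d) (R : realType)
    (mu : {measure set T -> \bar R}) (X Y : T -> R) :
  measurable_fun setT X -> measurable_fun setT Y ->
  (\int[mu]_x `|X x + Y x|%:E <=
   \int[mu]_x `|X x|%:E + \int[mu]_x `|Y x|%:E)%E.
Proof.
move=> mX mY.
have mn (Z : T -> R) :
    measurable_fun setT Z -> measurable_fun setT (fun x => `|Z x|%:E).
  by move=> mZ; apply/measurable_EFinP; exact: measurableT_comp.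
rewrite -ge0_integralD//; [|exact: mn|exact: mn].
apply: ge0_le_integral => //.
- by apply: mn; exact: measurable_funD.
- by apply: emeasurable_funD; exact: mn.
- by move=> x _; rewrite -EFinD lee_fin ler_normD.
Qed.

(** * Second moment of a sum of centred indicators *)

Section second_moment.
Context d (T : measurableType d) (R : realType) (P : probability T R).

Lemma bounded_integrable (g : T -> R) (M : R) :
  measurable_fun setT g -> (forall x, `|g x| <= M) ->
  P.-integrable setT (EFin \o g).
Proof.
move=> mg gM.
apply: (@le_integrable _ _ _ P _ _ _ (EFin \o cst M)) => //.
- exact/measurable_EFinP.
- move=> x _ /=; by rewrite lee_fin (le_trans (gM x))// ler_norm.
- exact: finite_measure_integrable_cst.
Qed.

(** Expanding the square leaves the products of two centred indicators. All events have the same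
    probability [p], so the mean of such a product is the covariance [P(B_i B_j) - p^2]. *)
Lemma integral_sqr_sum_indic_sub (B : nat -> set T) (p : R) (n : nat) :
  (forall i, measurable (B i)) -> (forall i, P (B i) = p%:E) ->
  (\int[P]_x ((\sum_(i < n) (\1_(B i) x - p)) ^+ 2)%:E =
   (\sum_(i < n) \sum_(j < n) (fine (P (B i `&` B j)) - p ^+ 2))%:E)%E.
Proof.
move=> mB PB.
have intB i j : P.-integrable setT (fun x =>
    ((\1_(B i) x - p) * (\1_(B j) x - p))%:E).
  apply: (@bounded_integrable _ ((1 + `|p|) ^+ 2)) => [|x].
    by apply: measurable_funM; apply: measurable_funB => //;
      exact: measurable_indic.
  rewrite normrM expr2 ler_pM// (le_trans (ler_normB _ _))// lerD2r.
    by rewrite indicE; case: (x \in _); rewrite ?normr1 ?normr0.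
  by rewrite indicE; case: (x \in _); rewrite ?normr1 ?normr0.
have Bfin i j : (\int[P]_x ((\1_(B i) x - p) * (\1_(B j) x - p))%:E =
    (fine (P (B i `&` B j)) - p ^+ 2)%:E)%E.
  have mBB : measurable (B i `&` B j) by exact: measurableI.
  have E x : (((\1_(B i) x - p) * (\1_(B j) x - p))%:E =
     ((\1_(B i `&` B j) x)%:E + ((- p)%:E * (\1_(B i) x)%:E
       + ((- p)%:E * (\1_(B j) x)%:E + cst (p ^+ 2)%:E x))))%E.
    by rewrite indicI -!EFinM -!EFinD; congr EFin => /=; ring.
  under eq_integral do rewrite E.
  have iB k : P.-integrable setT (fun x => ((- p)%:E * (\1_(B k) x)%:E)%E).
    by apply: integrableZl => //; exact: integrable_indic.
  have ic : P.-integrable setT (cst (p ^+ 2)%:E).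
    exact: finite_measure_integrable_cst.
  rewrite integralD//=; first last.
  - by apply: integrableD => //; exact: integrableD.
  - exact: integrable_indic.
  rewrite integralD//=; last exact: integrableD.
  rewrite integralD//= !integralZl//; try exact: integrable_indic.
  have -> : (\int[P]_x (\1_(B i `&` B j) x)%:E = (fine (P (B i `&` B j)))%:E)%E.
    by rewrite integral_indic// setIT fineK//; exact: fin_num_measure.
  have iE k : (\int[P]_x (\1_(B k) x)%:E = p%:E)%E.
    by rewrite integral_indic// setIT; exact: PB.
  have -> : (\int[P]_x cst (p ^+ 2)%:E x = (p ^+ 2)%:E)%E.
    rewrite integral_cst//; have P1 : P setT = 1%E by exact: probability_setT.
    by rewrite [X in (_ * X)%E]P1 mule1.
  rewrite !iE -!EFinM -!EFinD.
  by congr EFin; ring.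
under eq_integral.
  move=> x _; rewrite expr2 big_distrlr/= -sumEFin.
  under eq_bigr do rewrite -sumEFin; over.
rewrite integral_sum//; last by move=> i; apply: integrable_sum => // j _;
  exact: intB.
rewrite -sumEFin; apply: eq_bigr => i _.
rewrite integral_sum//.
by rewrite -sumEFin; apply: eq_bigr => j _; exact: Bfin.
Qed.

End second_moment.

(** * Counting index pairs near the diagonal *)

Lemma sum_near_diagonal_le (N i n : nat) :
  (\sum_(j < n) (i < j + N) && (j < i + N) <= N.*2)%N.
Proof.
(* The admissible [j] run from [i + 1 - N] to [i + N - 1], cut off at [n]. The exact count, with
   truncated subtraction, is what goes through induction on [n]. *)
suff -> : (\sum_(j < n) (i < j + N) && (j < i + N) =
   minn n (i + N) - minn n (i.+1 - N))%N by lia.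
elim: n => [|n IH]; first by rewrite big_ord0; lia.
by rewrite big_ord_recr/= IH; lia.
Qed.

(** In each row the far entries cost at most [e] each, and the at most [2N] entries near the
    diagonal cost at most 1 more each. *)
Lemma sum_pairs_le (R : realType) (b : nat -> nat -> R) (N n : nat) (e : R) :
  0 <= e ->
  (forall i j, b i j <= 1) ->
  (forall i j, (i + N <= j)%N || (j + N <= i)%N -> b i j <= e) ->
  \sum_(i < n) \sum_(j < n) b i j <= n%:R * (n%:R * e + N.*2%:R).
Proof.
move=> e0 b1 be.
have -> : n%:R * (n%:R * e + N.*2%:R) = \sum_(i < n) (n%:R * e + N.*2%:R).
  by rewrite sumr_const card_ord mulr_natl.
apply: ler_sum => i _.
apply: (@le_trans _ _ (\sum_(j < n) (e + ((i < j + N) && (j < i + N))%N%:R))).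
  apply: ler_sum => j _.
  have [far|near] := boolP ((i + N <= j)%N || (j + N <= i)%N).
    by rewrite (le_trans (be _ _ far))// lerDl.
  by rewrite (_ : _ && _ = true); [rewrite (le_trans (b1 _ _))// lerDr | lia].
rewrite big_split/=; apply: lerD; first
  by rewrite sumr_const card_ord mulr_natl.
by rewrite -natr_sum ler_nat sum_near_diagonal_le.
Qed.

(** * Mixing and the uniform L^1 law for indicators *)

Section uniform_L1_law.
Context {R : realType} {E : ptopologicalType}.
Implicit Types (P : probability (pathspace E) R) (g : borel E -> R).

(** This is the [D_n(g)] of the overview. For [n = 0] the inverse is 0, so the empirical mean is
    0. *)
Definition deviation g (n : nat) P (x : pathspace E) : R :=
  n%:R^-1 * \sum_(i < n) g (x i) - \int[marginal P 0]_y g y.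

Lemma measurable_comp_coord g i :
  measurable_fun setT g -> measurable_fun setT (fun x : pathspace E => g (x i)).
Proof. by move=> mg; exact: (measurableT_comp mg (@measurable_coord E i)). Qed.

Lemma measurable_deviation g n P :
  measurable_fun setT g -> measurable_fun setT (deviation g n P).
Proof.
move=> mg; apply: measurable_funB => //; apply: measurable_funM => //.
by apply: measurable_sum => i; exact: measurable_comp_coord.
Qed.

Lemma marginal_pair_mixing P i j (A : set (borel E)) :
  (i < j)%N -> measurable A ->
  (`|P (Defs.coord i @^-1` A `&` Defs.coord j @^-1` A)
     - P (Defs.coord i @^-1` A) * P (Defs.coord j @^-1` A)|
   <= strong_mixing P (j - i))%E.
Proof.
move=> ij mA; apply: le_ereal_sup_tmp.
(* With [k = i + 1] the past is generated by the coordinates up to [i], and a gap of [j - i] makes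
   the future start exactly at coordinate [j]. *)
eexists; first by exists i.+1.
apply: ereal_sup_ubound.
have sA k (J : set nat) : J k -> coord_sigma J (Defs.coord k @^-1` A).
  move=> Jk; apply: sub_sigma_algebra; exists k => //.
  by exists A => //; rewrite setTI.
exists (Defs.coord i @^-1` A); first by apply: sA => /=.
by exists (Defs.coord j @^-1` A) => //; apply: sA => /=; lia.
Qed.

Variable PP : set (probability (pathspace E) R).

(** Convergence to 0 of the supremum over [PP] of the L^1 norms, phrased without a supremum so that
    two such bounds combine by intersecting filter sets. *)
Definition uniformly_L1_null
    (D : nat -> probability (pathspace E) R -> pathspace E -> R) :=
  forall e : R, 0 < e -> \forall n \near \oo, forall P, PP P ->
    (\int[P]_x `|D n P x|%:E <= e%:E)%E.

Hypothesis identically_distributed : forall P, PP P ->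
  forall i (A : set (borel E)), measurable A ->
    marginal P i A = marginal P 0%N A.

Hypothesis uniformly_mixing :
  ereal_sup [set strong_mixing P n | P in PP] @[n --> \oo] --> 0%E.

(** A one-sided bound on the covariance, enough to bound a variance from above. The rank [N] is
    chosen before [P], which is where uniformity of the mixing enters. *)
Lemma mixing_pair_probability_le (A : set (borel E)) (e : R) :
  measurable A -> 0 < e ->
  exists N, forall P, PP P -> forall i j, (i + N <= j)%N || (j + N <= i)%N ->
    fine (P (Defs.coord i @^-1` A `&` Defs.coord j @^-1` A))
      - fine (marginal P 0 A) ^+ 2 <= e.
Proof.
move=> mA e0.
have [N _ mixN] := cvge0_lt _ uniformly_mixing e0.
(* The successor forces [i < j] even when [N = 0], as [marginal_pair_mixing] demands. *)
exists N.+1 => P PPP.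
have mc i : measurable (Defs.coord i @^-1` A).
  by rewrite -[X in measurable X]setTI; exact: measurable_coord.
suff main i j : (i + N.+1 <= j)%N ->
    fine (P (Defs.coord i @^-1` A `&` Defs.coord j @^-1` A))
      - fine (marginal P 0 A) ^+ 2 <= e.
  by move=> i j /orP[|/main]; [exact: main | rewrite setIC].
move=> ij; have ltij : (i < j)%N by lia.
have PA k : P (Defs.coord k @^-1` A) = (fine (marginal P 0 A))%:E.
  rewrite fineK ?fin_num_measure//; exact: (identically_distributed PPP k mA).
have mI : measurable (Defs.coord i @^-1` A `&` Defs.coord j @^-1` A)
  by exact: measurableI.
have := marginal_pair_mixing P ltij mA.
rewrite !PA -[P (_ `&` _)]fineK ?fin_num_measure//.
rewrite -EFinM -EFinB abse_EFin -expr2 => mixP.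
rewrite -lee_fin (le_trans _ (ltW (mixN (j - i)%N _)))//=; last by lia.
apply: le_trans (lee_abs _).
apply: (@le_trans _ _ (strong_mixing P (j - i)%N)).
  by apply: le_trans mixP; rewrite lee_fin ler_norm.
by apply: ereal_sup_ubound; exists P.
Qed.

Lemma deviation_indic_L1 (A : set (borel E)) : measurable A ->
  uniformly_L1_null (deviation \1_A).
Proof.
move=> mA e e0.
have mc i : measurable (Defs.coord i @^-1` A).
  by rewrite -[X in measurable X]setTI; exact: measurable_coord.
(* The three shares of [e] are the constant in [absD], the far pairs and the pairs near the
   diagonal. *)
pose r := e / 3; have r0 : 0 < r by rewrite divr_gt0.
have [N mixN] := mixing_pair_probability_le mA (exprn_gt0 2 r0).
near=> n; move=> P PPP.
have n0 : 0 < n%:R :> R by rewrite ltr0n; near: n; exists 1%N.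
have nN : N.*2%:R / r ^+ 2 <= n%:R :> R by near: n; exact: nbhs_infty_ger.
set p := fine (marginal P 0 A).
have PA k : P (Defs.coord k @^-1` A) = p%:E.
  rewrite /p fineK ?fin_num_measure//;
    exact: (identically_distributed PPP k mA).
pose S x := \sum_(i < n) (\1_(Defs.coord i @^-1` A) x - p) : R.
have mS : measurable_fun setT S.
  by apply: measurable_sum => i; apply: measurable_funB => //;
    exact: measurable_indic.
have devE x : deviation \1_A n P x = n%:R^-1 * S x.
  rewrite /deviation /S sumrB mulrBr sumr_const card_ord -[p *+ n]mulr_natl.
  by rewrite mulKf ?lt0r_neq0// /Rintegral integral_indic// setIT.
have i0 : 0 <= n%:R^-1 :> R by rewrite invr_ge0 ltW.
(* The inequality [t <= r + t^2 / r] for [t = |D_n|] passes from the second moment to the first. It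
   follows by completing the square in [r^2 - r t + t^2]. *)
have absD x : `|deviation \1_A n P x| <= r + (r^-1 * n%:R ^- 2) * S x ^+ 2.
  rewrite devE normrM ger0_norm// -[S x ^+ 2]real_normK ?num_real//.
  set s := `|S x|; rewrite -subr_ge0.
  have -> : r + r^-1 * n%:R ^- 2 * s ^+ 2 - n%:R^-1 * s =
      r^-1 * ((r - n%:R^-1 * s / 2) ^+ 2 + 3 / 4 * (n%:R^-1 * s) ^+ 2).
    by field; rewrite !lt0r_neq0.
  rewrite mulr_ge0 ?invr_ge0 ?(ltW r0)//.
  by rewrite addr_ge0 ?sqr_ge0// mulr_ge0 ?sqr_ge0.
have c0 : 0 <= r^-1 * n%:R ^- 2 :> R.
  by rewrite mulr_ge0 ?invr_ge0 ?exprn_ge0 ?ltW.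
apply: (@le_trans _ _
    (\int[P]_x (r%:E + (r^-1 * n%:R ^- 2)%:E * (S x ^+ 2)%:E))%E).
  apply: ge0_le_integral => //.
  - apply/measurable_EFinP; apply: measurableT_comp => //.
    by apply: measurable_deviation; exact: measurable_indic.
  - apply: emeasurable_funD => //; apply: emeasurable_funM => //.
    by apply/measurable_EFinP; exact: measurable_funX.
  - by move=> x _; rewrite -EFinM -EFinD lee_fin.
rewrite ge0_integralD//; first last.
- by apply: emeasurable_funM => //; apply/measurable_EFinP;
    exact: measurable_funX.
- by move=> x _; rewrite mule_ge0 ?lee_fin ?sqr_ge0.
- by move=> x _; rewrite lee_fin ltW.
rewrite ge0_integralZl//; first last.
- by move=> x _; rewrite lee_fin sqr_ge0.
- by apply/measurable_EFinP; exact: measurable_funX.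
rewrite integral_cst//.
have P1 : P setT = 1%E by exact: probability_setT.
rewrite [X in (r%:E * X)%E]P1 mule1.
have -> := integral_sqr_sum_indic_sub n mc PA.
rewrite -EFinM -EFinD lee_fin.
have var : \sum_(i < n) \sum_(j < n)
    (fine (P (Defs.coord i @^-1` A `&` Defs.coord j @^-1` A)) - p ^+ 2)
    <= n%:R * (n%:R * r ^+ 2 + N.*2%:R).
  apply: (@sum_pairs_le _ (fun i j =>
    fine (P (Defs.coord i @^-1` A `&` Defs.coord j @^-1` A)) - p ^+ 2)) => [|i
      j|].
  - exact: sqr_ge0.
  - rewrite lerBlDr -lee_fin fineK ?fin_num_measure//; last exact: measurableI.
    apply: le_trans (probability_le1 P (measurableI _ _ (mc i) (mc j))) _.
    by rewrite lee_fin lerDl sqr_ge0.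
  - exact: mixN.
apply: le_trans (lerD (lexx r) (ler_wpM2l c0 var)) _.
(* The far pairs give [r]. The near ones give [r] times a factor that [nN] keeps below 1. *)
have -> : r^-1 * n%:R ^- 2 * (n%:R * (n%:R * r ^+ 2 + N.*2%:R)) =
    r + r * (N.*2%:R / r ^+ 2 / n%:R).
  by field; rewrite !lt0r_neq0.
have : r * (N.*2%:R / r ^+ 2 / n%:R) <= r
  by rewrite ger_pMr// ler_pdivrMr// mul1r.
by move=> h; rewrite /r in h *; lra.
Unshelve. all: by end_near. Qed.

(** * Linearity and L^1 approximation *)

Lemma integral_comp_coord P i (h : borel E -> \bar R) :
  PP P -> measurable_fun setT h -> (forall y, 0 <= h y)%E ->
  (\int[P]_x h (x i) = \int[marginal P 0]_y h y)%E.
Proof.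
move=> PPP mh h0.
rewrite -[LHS](ge0_integral_distribution (@Defs.coord E i) mh h0).
by apply: eq_measure_integral => A mA _; exact: identically_distributed.
Qed.

(** Both the empirical mean and the [P_1]-mean contribute at most the integral of [|g|]. The bound
    holds for every [n], so approximation errors stay controlled uniformly. *)
Lemma integral_deviation_le g n P : PP P ->
  measurable_fun setT g -> (marginal P 0).-integrable setT (EFin \o g) ->
  (\int[P]_x `|deviation g n P x|%:E
     <= 2%:E * \int[marginal P 0]_y `|g y|%:E)%E.
Proof.
move=> PPP mg ig.
have mag : measurable_fun setT (fun y => `|g y|%:E).
  by apply/measurable_EFinP; exact: measurableT_comp.
have [_ ag] := integrableP _ _ _ ig.
set c := (\int[marginal P 0]_y `|g y|%:E)%E.
have c0 : (0 <= c)%E by apply: integral_ge0 => y _; rewrite lee_fin.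
have cfin : c \is a fin_num by rewrite ge0_fin_numE.
have absD x : (`|deviation g n P x|%:E <=
    n%:R^-1%:E * (\sum_(i < n) `|g (x i)|%:E) + cst c x)%E.
  rewrite /= /deviation (@le_trans _ _ (`|n%:R^-1 * \sum_(i < n) g (x i)|
      + `|\int[marginal P 0]_y g y|)%:E)//.
    by rewrite lee_fin ler_normB.
  rewrite EFinD leeD//.
    rewrite sumEFin -EFinM lee_fin normrM ger0_norm ?invr_ge0//.
    by rewrite ler_wpM2l ?invr_ge0// ler_norm_sum.
  rewrite EFin_normr_Rintegral//; apply: le_abse_integral => //.
  exact/measurable_EFinP.
have msum : measurable_fun setT
    (fun x : pathspace E => \sum_(i < n) `|g (x i)|%:E)%E.
  apply: emeasurable_sum => i; apply/measurable_EFinP;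
    apply: measurableT_comp => //.
  exact: measurable_comp_coord.
have sum0 (x : pathspace E) : (0 <= \sum_(i < n) `|g (x i)|%:E)%E.
  by apply: sume_ge0 => i _; rewrite lee_fin.
apply: (@le_trans _ _ (\int[P]_x
    (n%:R^-1%:E * (\sum_(i < n) `|g (x i)|%:E) + cst c x))%E).
  apply: ge0_le_integral => //.
  - apply/measurable_EFinP; apply: measurableT_comp => //.
    exact: measurable_deviation.
  - by apply: emeasurable_funD => //; exact: emeasurable_funM.
have P1 : P setT = 1%E by exact: probability_setT.
rewrite ge0_integralD//; first last.
- exact: emeasurable_funM.
- by move=> x _; rewrite mule_ge0// lee_fin invr_ge0.
rewrite integral_cst// [X in (_ + c * X)%E]P1 mule1.
rewrite ge0_integralZl//.
rewrite ge0_integral_sum//; last first.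
  move=> i; apply/measurable_EFinP; apply: measurableT_comp => //.
  exact: measurable_comp_coord.
under eq_bigr do rewrite (@integral_comp_coord _ _ (fun y => `|g y|%:E))//.
rewrite -/c -(fineK cfin) sumEFin sumr_const card_ord.
rewrite -!EFinM -EFinD lee_fin.
have fc0 : 0 <= fine c by exact: fine_ge0.
rewrite -[fine c *+ n]mulr_natl mulrA [2 * _]mulr_natl mulr2n lerD2r ler_piMl//.
(* The factor [n^-1 * n] is 0 for [n = 0] and 1 otherwise. *)
by case: n {absD msum sum0} => [|n]; rewrite ?mulr0// mulVf// pnatr_eq0.
Qed.

Lemma deviationD g1 g2 n P :
  (marginal P 0).-integrable setT (EFin \o g1) ->
  (marginal P 0).-integrable setT (EFin \o g2) ->
  deviation (g1 \+ g2) n P = deviation g1 n P \+ deviation g2 n P.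
Proof.
move=> i1 i2; apply/funext => x; rewrite /deviation /= RintegralD// big_split/=.
by rewrite mulrDr; ring.
Qed.

Lemma deviationZ (c : R) g n P :
  (marginal P 0).-integrable setT (EFin \o g) ->
  deviation (c \*o g) n P = c \*o deviation g n P.
Proof.
move=> ig; apply/funext => x; rewrite /deviation /= RintegralZl// -mulr_sumr.
by rewrite mulrBr; ring.
Qed.

(** Integrability is part of the class because [deviation] is linear in [g] only where the
    real-valued integral is additive. *)
Definition uniform_L1_lln g :=
  [/\ measurable_fun setT g,
      forall P, PP P -> (marginal P 0).-integrable setT (EFin \o g) &
      uniformly_L1_null (deviation g)].

Lemma uniform_L1_lln_indic (A : set (borel E)) :
  measurable A -> uniform_L1_lln \1_A.
Proof.
move=> mA; split; first exact: measurable_indic.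
- by move=> P _; exact: integrable_indic.
- exact: deviation_indic_L1.
Qed.

Lemma uniform_L1_llnD g1 g2 :
  uniform_L1_lln g1 -> uniform_L1_lln g2 -> uniform_L1_lln (g1 \+ g2).
Proof.
move=> [m1 i1 u1] [m2 i2 u2]; split; first exact: measurable_funD.
  move=> P PPP;
    apply: (integrableD measurableT (f := EFin \o g1) (g := EFin \o g2)).
    exact: i1.
  exact: i2.
move=> e e0; have e20 : 0 < e / 2 by rewrite divr_gt0.
have := u2 _ e20; have := u1 _ e20; apply: filterS2 => n b1 b2 P PPP.
rewrite deviationD; [|exact: i1|exact: i2].
apply: le_trans (integral_normD_le _ _ _) _; try exact: measurable_deviation.
by rewrite (splitr e) EFinD; apply: leeD; [exact: b1|exact: b2].
Qed.

Lemma uniform_L1_llnZ (c : R) g : uniform_L1_lln g -> uniform_L1_lln (c \*o g).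
Proof.
move=> [mg ig ug]; split; first exact: measurable_funM.
  by move=> P PPP; exact: (integrableZl measurableT c (ig P PPP)).
move=> e e0.
(* Adding 1 keeps the divisor positive when [c = 0]. *)
have c0 : 0 < `|c| + 1 by rewrite ltr_wpDl.
have : 0 < e / (`|c| + 1) by rewrite divr_gt0.
move=> /ug; apply: filterS => n b P PPP.
rewrite deviationZ; last exact: ig.
under eq_integral do rewrite /= normrM EFinM.
rewrite ge0_integralZl//; last first.
  by apply/measurable_EFinP; apply: measurableT_comp => //;
    exact: measurable_deviation.
apply: (@le_trans _ _ (`|c|%:E * (e / (`|c| + 1))%:E)%E).
  apply: lee_pmul => //; first by apply: integral_ge0 => x _; rewrite lee_fin.
  exact: b.
by rewrite -EFinM lee_fin mulrCA ger_pMr// ler_pdivrMr// mul1r lerDl.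
Qed.

Lemma uniform_L1_lln_sum (I : Type) (s : seq I) (h : I -> borel E -> R) :
  (forall i, uniform_L1_lln (h i)) ->
  uniform_L1_lln (fun y => \sum_(i <- s) h i y).
Proof.
move=> uh; elim: s => [|i s IH].
  rewrite (_ : (fun y => _) = \1_set0); first exact: uniform_L1_lln_indic.
  by apply/funext => y; rewrite big_nil indic0.
rewrite (_ : (fun y => _) = h i \+ (fun y => \sum_(i <- s) h i y)).
  exact: (uniform_L1_llnD (uh i) IH).
by apply/funext => y; rewrite big_cons.
Qed.

(** Split [D_n(g) = D_n(g - s) + D_n(s)]. The first term is small for every [n] by
    [integral_deviation_le], the second for large [n]. With an approximation within [e / 4], the
    factor 2 turns the first into [e / 2]. *)
Lemma uniform_L1_lln_approx g : measurable_fun setT g ->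
  (forall e : R, 0 < e -> exists2 s : borel E -> R, uniform_L1_lln s &
     forall P, PP P -> (\int[marginal P 0]_y `|g y - s y|%:E <= e%:E)%E) ->
  uniform_L1_lln g.
Proof.
move=> mg approx.
have gE (s : borel E -> R) : g = (g \- s) \+ s by apply/funext => y /=;
  rewrite subrK.
have igs (s : borel E -> R) (e : R) P : measurable_fun setT s ->
    (\int[marginal P 0]_y `|g y - s y|%:E <= e%:E)%E ->
    (marginal P 0).-integrable setT (EFin \o (g \- s)).
  move=> ms gs; apply/integrableP; split.
    by apply/measurable_EFinP; exact: measurable_funB.
  by apply: le_lt_trans gs _; rewrite ltry.
split=> //.
  move=> P PPP; have [s [ms ints _] gs] := approx 1 ltr01.
  rewrite (gE s);
    apply: (integrableD measurableT (f := EFin \o (g \- s)) (g := EFin \o s)).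
    exact: (igs _ _ _ ms (gs _ PPP)).
  exact: ints.
move=> e e0; have e40 : 0 < e / 4 by rewrite divr_gt0.
have [s [ms ints us] gs] := approx _ e40.
have e20 : 0 < e / 2 by rewrite divr_gt0.
move: (us _ e20); apply: filterS => n b P PPP.
have gsP := igs _ _ _ ms (gs _ PPP).
rewrite (gE s) deviationD//; last exact: ints.
have mgs : measurable_fun setT (g \- s) by exact: measurable_funB.
apply: le_trans (integral_normD_le _ _ _) _; try exact: measurable_deviation.
rewrite (splitr e) EFinD; apply: leeD; last exact: b.
apply: le_trans (integral_deviation_le _ PPP mgs gsP) _.
rewrite (_ : e / 2 = 2 * (e / 4)); last by field.
by rewrite EFinM lee_pmul2l//; exact: gs.
Qed.

(** * Uniformly integrable and bounded functions *)

Lemma sum_ltn_minn (J m : nat) : (\sum_(j < J) (j < m) = minn J m)%N.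
Proof.
elim: J => [|J IH]; first by rewrite big_ord0 min0n.
by rewrite big_ord_recr/= IH; lia.
Qed.

(* The approximants are the staircase functions [min(J, floor(L g)) / L], which
   are linear combinations of indicators of superlevel sets. *)
Lemma uniform_L1_lln_uniformly_integrable g :
  measurable_fun setT g -> (forall y, 0 <= g y) ->
  (forall e : R, 0 < e -> exists K : R, forall P, PP P ->
    (\int[marginal P 0]_y (g y * \1_[set z | K <= g z] y)%:E <= e%:E)%E) ->
  uniform_L1_lln g.
Proof.
move=> mg g0 ui; apply: uniform_L1_lln_approx => // e e0.
have e20 : 0 < e / 2 by rewrite divr_gt0.
have [K gK] := ui _ e20.
(* The steps of the staircase have height [1 / L], at most [e / 2]. *)
pose L := (Num.trunc (e / 2)^-1).+1.
have L0 : 0 < L%:R :> R by rewrite ltr0n.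
have Le : L%:R^-1 <= e / 2.
  by rewrite invf_ple ?posrE// ltW// truncnS_gt.
(* With this many steps the cap [J] is inactive wherever [g < K]. *)
pose J := (Num.trunc (L%:R * `|K|)).+1.
pose A (j : nat) : set (borel E) := [set y | j.+1%:R <= L%:R * g y].
have mA j : measurable (A j).
  rewrite -[X in measurable X]setTI.
  by apply: measurable_fun_le => //; exact: measurable_funM.
pose s y := L%:R^-1 * \sum_(j < J) \1_(A j) y : R.
exists s.
  apply: (@uniform_L1_llnZ _ (fun y => \sum_(j < J) \1_(A j) y)).
  by apply: uniform_L1_lln_sum => j; exact: uniform_L1_lln_indic.
have sE y : s y = L%:R^-1 * (minn J (Num.trunc (L%:R * g y)))%:R.
  rewrite /s; congr (_ * _); rewrite -sum_ltn_minn natr_sum;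
    apply: eq_bigr => j _.
  rewrite indicE; congr (_ %:R); congr nat_of_bool.
  apply/idP/idP; rewrite inE /A /= => h.
    by rewrite truncn_ge_nat// mulr_ge0// ltW.
  by rewrite -truncn_ge_nat// mulr_ge0// ltW.
have gs0 y : 0 <= g y - s y.
  rewrite subr_ge0 sE ler_pdivrMl//.
  apply: (@le_trans _ _ (Num.trunc (L%:R * g y))%:R).
    by rewrite ler_nat geq_minr.
  by rewrite truncn_le mulr_ge0// ltW.
have mK : measurable ([set z | K <= g z] : set (borel E)).
  by rewrite -[X in measurable X]setTI; apply: measurable_fun_le.
have ms : measurable_fun setT s.
  apply: measurable_funM => //; apply: measurable_sum => j;
    exact: measurable_indic.
have mgK : measurable_fun (setT : set (borel E))
    (fun y => (g y * \1_[set z | K <= g z] y)%:E).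
  by apply/measurable_EFinP; apply: measurable_funM => //;
    exact: measurable_indic.
(* Where [g < K] the error is pure rounding, at most [1 / L]. Where [g >= K] it is at most [g],
   because [s] is nonnegative. *)
have gsle y : g y - s y <= e / 2 + g y * \1_[set z | K <= g z] y.
  rewrite indicE; have [Kg|gltK] := leP K (g y).
    rewrite mem_set//= mulr1 ler_wpDl ?(ltW e20)//.
    by rewrite gerBl /s mulr_ge0 ?invr_ge0 ?sumr_ge0// ltW.
  rewrite memNset/= ?mulr0 ?addr0; last by apply/negP; rewrite -ltNge.
  apply: le_trans Le; rewrite sE (minn_idPr _); last first.
    rewrite /J ltnW// ltnS le_truncn// ler_wpM2l ?(ltW L0)//.
    by rewrite (le_trans (ltW gltK))// ler_norm.
  rewrite lerBlDl -[X in _ + X]mulr1 -mulrDr ler_pdivlMl// natr1.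
  by rewrite ltW// truncnS_gt.
move=> P PPP.
apply: (@le_trans _ _ (\int[marginal P 0]_y
    (cst (e / 2)%:E y + (g y * \1_[set z | (K <= g z)%R] y)%:E))%E).
  apply: ge0_le_integral => //.
  - by apply/measurable_EFinP; apply: measurableT_comp => //;
      exact: measurable_funB.
  - exact: emeasurable_funD.
  - by move=> y _; rewrite ger0_norm// -EFinD lee_fin.
have P1 : marginal P 0 setT = 1%E by exact: probability_setT.
rewrite ge0_integralD//; first last.
- by move=> y _; rewrite lee_fin mulr_ge0.
- by move=> y _; rewrite lee_fin ltW.
rewrite integral_cst// [X in (_ * X)%E]P1 mule1.
rewrite [in leRHS](splitr e) EFinD leeD//.
exact: gK.
Qed.

Lemma uniform_L1_lln_bounded g (M : R) :
  measurable_fun setT g -> (forall y, `|g y| <= M) -> uniform_L1_lln g.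
Proof.
move=> mg gM.
(* Shifting by [M] makes the function nonnegative, and the constant subtracted again is a multiple
   of an indicator. *)
have -> : g = (g \+ cst M) \+ (- M) \*o \1_setT.
  by apply/funext => y /=; rewrite indicT /= mulr1 addrK.
apply: uniform_L1_llnD; last by apply: uniform_L1_llnZ;
  exact: uniform_L1_lln_indic.
apply: uniform_L1_lln_uniformly_integrable; first exact: measurable_funD.
  by move=> y /=; rewrite -lerBlDr sub0r; have := gM y;
    rewrite ler_norml => /andP[].
(* The shifted function is at most [2M], so its superlevel set at this height is empty. *)
move=> e e0; exists (M + M + 1) => P _.
rewrite integral0_eq ?lee_fin ?ltW// => y _.
rewrite indicE memNset ?mulr0//=; apply/negP; rewrite -ltNge.
have := le_trans (ler_norm _) (gM y); lra.
Qed.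

End uniform_L1_law.

(** * Test functions and integrals against the empirical measure *)

Lemma Cc_bounded (R : realType) (E : ptopologicalType) (g : E -> R) :
  Cc g -> exists M, forall x, `|g x| <= M.
Proof.
move=> [cg Kg].
have /compact_bounded[M [_ gM]] : compact (g @` closure [set x | g x != 0]).
  by apply: continuous_compact => //; exact: continuous_subspaceT.
exists (`|M| + 1) => x.
have [->|gx0] := eqVneq (g x) 0; first by rewrite normr0 addr_ge0.
apply: (gM (`|M| + 1)); first by rewrite (le_lt_trans (ler_norm M))// ltrDl.
by exists x => //; exact: subset_closure.
Qed.

Lemma Rintegral_empirical (R : realType) (E : ptopologicalType)
    (g : borel E -> R) n (x : pathspace E) :
  measurable_fun setT g ->
  \int[empirical n x]_y g y = n%:R^-1 * \sum_(i < n) g (x i).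
Proof.
move=> mg.
(* The nonnegative case comes first; the general one follows by applying it to the positive and
   negative parts. *)
have ge0E (h : borel E -> R) : measurable_fun setT h -> (forall y, 0 <= h y) ->
    (\int[@empirical R E n x]_y (h y)%:E =
      (n%:R^-1 * \sum_(i < n) h (x i))%:E)%E.
  move=> mh h0; have mhE : measurable_fun setT (EFin \o h)
    by exact/measurable_EFinP.
  rewrite /empirical ge0_integral_mscale//=; last first.
    by move=> y _; rewrite lee_fin.
  rewrite ge0_integral_measure_sum//; last by move=> y _; rewrite lee_fin.
  rewrite (eq_bigr (fun i : 'I_n => (h (x i))%:E)) => [|i _].
    by rewrite sumEFin -EFinM.
  rewrite (integral_dirac _ measurableT mhE) diracT mul1e//.
have maxB (r : R) : Num.max r 0 - Num.max (- r) 0 = r.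
  have [r0|r0] := leP 0 r; first by rewrite max_r ?oppr_le0// subr0.
  by rewrite max_l ?oppr_ge0 ?ltW// sub0r opprK.
rewrite /Rintegral integralE.
under eq_integral do rewrite funeposE -EFin_max.
under [X in (_ - X)%E]eq_integral do rewrite funenegE -EFinN -EFin_max.
rewrite !ge0E; first last.
- by move=> y; rewrite le_max lexx orbT.
- exact: measurable_maxr.
- by move=> y; rewrite le_max lexx orbT.
- by apply: measurable_maxr => //; exact: measurableT_comp.
rewrite -EFinB/= -mulrBr -sumrB; congr (_ * _); apply: eq_bigr => i _.
exact: maxB.
Qed.

(** * The weighted series that defines the vague distance *)

Lemma halves_tail_le (R : realType) (u : nat -> R) (m n : nat) :
  (forall k, u k <= 2 ^- k.+1) ->
  \sum_(m <= k < n) u k <= 2 ^- m.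
Proof.
move=> u_le; have [nm|mn] := leqP n m.
  by rewrite big_geq// invr_ge0 exprn_ge0.
(* Since [2^-(k+1) = 2^-k - 2^-(k+1)], the dominating sum telescopes. *)
apply: (@le_trans _ _ (\sum_(m <= k < n) (- 2 ^- k.+1 - - 2 ^- k))).
  apply: ler_sum => k _; apply: le_trans (u_le k) _.
  by rewrite le_eqVlt; apply/orP; left; apply/eqP; rewrite exprS; field.
rewrite telescope_sumr ?(ltnW mn)// opprK addrC gerBl.
by rewrite invr_ge0 exprn_ge0.
Qed.

Section weighted_series.
Context {R : realType} (u : nat -> R).
Hypothesis u0 : forall k, 0 <= u k.

Let v k := 2 ^- k.+1 * Num.min 1 (u k).

Let v0 k : 0 <= v k.
Proof. by rewrite mulr_ge0 ?invr_ge0 ?exprn_ge0// le_min ler01 u0. Qed.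

Lemma weighted_series_le N n : series v n <= \sum_(k < N) u k + 2 ^- N.
Proof.
(* Lengthening the partial sum to at least [N] terms allows a split at [N] whatever [n] is. *)
apply: (@le_trans _ _ (series v (maxn n N))).
  by apply: nondecreasing_series => //; rewrite leq_maxl.
rewrite seriesEnat/= (big_cat_nat (n := N)) ?leq_maxr//= big_mkord lerD//.
  apply: ler_sum => k _; apply: (@le_trans _ _ (1 * u k)); last
    by rewrite mul1r.
  apply: ler_pM;
    rewrite ?invr_ge0 ?exprn_ge0 ?le_min ?ler01 ?u0// ?ge_min ?lexx ?orbT//.
  by rewrite invf_le1 ?exprn_gt0// exprn_ege1// ler1n.
apply: halves_tail_le => k.
by rewrite /v ler_piMr ?invr_ge0 ?exprn_ge0// ge_min lexx.
Qed.

Lemma is_cvg_weighted_series : cvgn (series v).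
Proof.
apply: nondecreasing_is_cvgn.
  by apply/nondecreasing_seqP => n; rewrite seriesSr lerDl.
exists (2 ^- 0) => _ [n _ <-].
by have := weighted_series_le 0 n; rewrite big_ord0 add0r.
Qed.

Lemma lim_weighted_series_le N :
  limn (series v) <= \sum_(k < N) u k + 2 ^- N.
Proof.
apply: limr_le; first exact: is_cvg_weighted_series.
by apply: nearW => n; exact: weighted_series_le.
Qed.

Lemma lim_weighted_series_ge0 : 0 <= limn (series v).
Proof.
apply: limr_ge; first exact: is_cvg_weighted_series.
by apply: nearW => n; exact: sumr_ge0.
Qed.

End weighted_series.

(** * Mean convergence of the distance *)

Section distance.
Context {R : realType} {E : ptopologicalType}.
Variables (PP : set (probability (pathspace E) R)) (psi : E -> R) (f : nat ->
  E -> R).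
Hypothesis psi_lln : uniform_L1_lln PP psi.
Hypothesis f_lln : forall k, uniform_L1_lln PP (f k).

Lemma d_psi_vag_deviationE n (P : probability (pathspace E) R) x :
  d_psi_vag psi f (empirical n x) (marginal P 0) =
  limn (series (fun k => 2 ^- k.+1 * Num.min 1 `|deviation (f k) n P x|))
  + `|deviation psi n P x|.
Proof.
have [mpsi _ _] := psi_lln.
rewrite /d_psi_vag /d_vag Rintegral_empirical//; congr (limn (series _) + _).
apply/funext => k; have [mf _ _] := f_lln k.
by rewrite Rintegral_empirical.
Qed.

Lemma measurable_d_psi_vag n (P : probability (pathspace E) R) :
  measurable_fun setT
    (fun x => d_psi_vag psi f (empirical n x) (marginal P 0)).
Proof.
rewrite (funext (@d_psi_vag_deviationE n P)).
have mdev g : uniform_L1_lln PP g -> measurable_fun setT (fun x => `|deviation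
  g n P x|).
  by move=> [mg _ _]; apply: measurableT_comp => //;
    exact: measurable_deviation.
apply: measurable_funD; last exact: (mdev _ psi_lln).
(* The limit of the series is a pointwise limit of measurable partial sums. *)
apply: (@measurable_fun_cvg _ _ _ _ (fun m x =>
  series (fun k => 2 ^- k.+1 * Num.min 1 `|deviation (f k) n P x|) m)).
  move=> m; apply: measurable_sum => k; apply: measurable_funM => //.
  by apply: measurable_minr; [exact: measurable_cst|exact: (mdev _ (f_lln k))].
by move=> x _; exact: is_cvg_weighted_series.
Qed.

(** A third of [e] goes to each of the tail of the series, its first [N] terms and the [psi] term.
    The truncation [N] depends on [e] alone, so only finitely many laws of large numbers must hold
    at once. *)
Lemma uniformly_L1_null_d_psi_vag :
  uniformly_L1_null PP (fun n P x => d_psi_vag psi f (empirical n x) (marginal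
    P 0)).
Proof.
have mdev g n P : uniform_L1_lln PP g ->
    measurable_fun setT (fun x => `|deviation g n P x|%:E).
  move=> [mg _ _]; apply/measurable_EFinP; apply: measurableT_comp => //.
  exact: measurable_deviation.
have msum N n P : measurable_fun setT
    (fun x => \sum_(k < N) `|deviation (f k) n P x|%:E)%E.
  by apply: emeasurable_sum => k; exact: (mdev _ _ _ (f_lln k)).
have sum_null N (e : R) : 0 < e -> \forall n \near \oo, forall P, PP P ->
    (\int[P]_x (\sum_(k < N) `|deviation (f k) n P x|%:E) <= e%:E)%E.
  elim: N e => [|N IH] e e0.
    apply: nearW => n P _; under eq_integral do rewrite big_ord0.
    by rewrite integral0 lee_fin ltW.
  have e20 : 0 < e / 2 by rewrite divr_gt0.
  have [_ _ fN] := f_lln N.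
  move: (IH _ e20) (fN _ e20); apply: filterS2 => n b1 b2 P PPP.
  under eq_integral do rewrite big_ord_recr/=.
  rewrite ge0_integralD//; first last.
  - exact: (mdev _ _ _ (f_lln N)).
  - exact: msum.
  - by move=> x _; apply: sume_ge0.
  by rewrite (splitr e) EFinD; apply: leeD; [exact: b1|exact: b2].
move=> e e0; have e30 : 0 < e / 3 by rewrite divr_gt0.
have [N Ne] : exists N, 2 ^- N <= e / 3.
  (* This [N] exceeds [3 / e], and [2^N > N]. *)
  exists (Num.trunc (e / 3)^-1).+1.
  rewrite invf_ple ?posrE ?exprn_gt0//.
  apply: (@le_trans _ _ ((Num.trunc (e / 3)^-1).+1%:R)).
    by rewrite ltW// truncnS_gt.
  by rewrite -natrX ler_nat ltnW// ltn_expl.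
have [_ _ psi0] := psi_lln.
move: (sum_null N _ e30) (psi0 _ e30); apply: filterS2 => n b1 b2 P PPP.
apply: (@le_trans _ _ (\int[P]_x (\sum_(k < N) `|deviation (f k) n P x|%:E
    + (`|deviation psi n P x|%:E + cst (e / 3)%:E x)))%E).
  apply: ge0_le_integral => //.
  - apply/measurable_EFinP; apply: measurableT_comp => //.
    exact: measurable_d_psi_vag.
  - apply: emeasurable_funD => //; apply: emeasurable_funD => //.
    exact: (mdev _ _ _ psi_lln).
  - move=> x _;
      rewrite d_psi_vag_deviationE [cst _ _]/= sumEFin -!EFinD lee_fin.
    rewrite ger0_norm; last first.
      by rewrite addr_ge0//; exact: lim_weighted_series_ge0.
    rewrite addrA addrAC lerD2r.
    apply: le_trans (lim_weighted_series_le (fun k => normr_ge0 _) N) _.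
    by rewrite lerD2l.
have P1 : P setT = 1%E by exact: probability_setT.
rewrite ge0_integralD//; first last.
- by apply: emeasurable_funD => //; exact: (mdev _ _ _ psi_lln).
- by move=> x _; rewrite -EFinD lee_fin addr_ge0// ltW.
- by move=> x _; exact: sume_ge0.
rewrite ge0_integralD//; first last.
- by move=> x _; rewrite lee_fin ltW.
- exact: (mdev _ _ _ psi_lln).
rewrite integral_cst// [X in (_ + (_ + _ * X))%E]P1 mule1.
rewrite [in leRHS](_ : e = e / 3 + (e / 3 + e / 3)); last by field.
rewrite !EFinD; apply: leeD; first exact: b1.
by apply: leeD; [exact: b2|exact: lexx].
Qed.

End distance.

(** * From mean convergence to convergence in probability *)

Theorem theorem3p9 (R : realType) (E : ptopologicalType)
  (lcE : locally_compact [set: E]) (scE : @second_countable E)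
  (hE : hausdorff_space E)
  (psi : E -> R) (psi_cont : continuous psi) (psi_ge0 : forall x, 0 <= psi x)
  (psi_ge1 : exists2 K : set E, compact K & forall x, ~ K x -> 1 <= psi x)
  (f : nat -> E -> R) (f_dense : dense_sequence_in_Cc f)
  (PP : set (probability (pathspace E) R))
  (identically_distributed : forall P, PP P ->
     forall i (A : set (borel E)), measurable A ->
       marginal P i A = marginal P 0%N A)
  (uniformly_integrable :
     ereal_sup [set (\int[marginal P 0%N]_y
                       (psi y * \1_[set z | K <= psi z] y)%:E)%E | P in PP]
       @[K --> +oo] --> 0%E)
  (uniformly_mixing :
     ereal_sup [set strong_mixing P n | P in PP] @[n --> \oo] --> 0%E)
  (delta : R) (delta_gt0 : 0 < delta) :
  ereal_sup [set P [set x | delta <=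
                      d_psi_vag psi f (empirical n x) (marginal P 0%N)] | P in PP]
    @[n --> \oo] --> 0%E.
Proof.
have psi_lln : uniform_L1_lln PP psi.
  apply: uniform_L1_lln_uniformly_integrable => //.
    exact: continuous_measurable_borel.
  move=> e e0.
  (* A single cut-off [K] serves every [P] in the class. *)
  have [K supK] := filter_ex (cvge0_lt _ uniformly_integrable e0).
  exists K => P PPP; apply: le_trans (ltW supK); apply: le_trans (lee_abs _).
  by apply: ereal_sup_ubound; exists P.
have f_lln k : uniform_L1_lln PP (f k).
  have [fC _] := f_dense; have [M fM] := Cc_bounded (fC k).
  apply: (uniform_L1_lln_bounded _ _ _ fM) => //.
  by apply: continuous_measurable_borel; have [] := fC k.
(* A supremum over the empty class is [-oo], which the mixing hypothesis rules out. A member of the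
   class is what makes the supremum in the conclusion nonnegative. *)
have [P0 PP0] : PP !=set0.
  apply/set0P/negP => /eqP PPe.
  have [n _ /(_ n (leqnn n))] := cvge0_lt _ uniformly_mixing ltr01.
  by rewrite PPe image_set0 ereal_sup0 /= ltNge leey.
have mD n P : measurable [set x : pathspace E |
    delta <= d_psi_vag psi f (empirical n x) (marginal P 0)].
  rewrite -[X in measurable X]setTI; apply: measurable_fun_le => //.
  exact: (measurable_d_psi_vag psi_lln f_lln).
apply: cvge0_near.
  apply: nearW => n; apply: le_ereal_sup_tmp.
  by eexists; first by exists P0.
(* Markov's inequality divides the mean by [delta], so the mean is taken below [delta * e]. *)
move=> e e0; have ed0 : 0 < delta * e by rewrite mulr_gt0.
move: (uniformly_L1_null_d_psi_vag psi_lln f_lln ed0).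
apply: filterS => n b; apply: ge_ereal_sup => _ [P PPP <-].
rewrite -(lee_pmul2l (x := delta%:E))// -EFinM.
apply: le_trans (b _ PPP).
have mdE : measurable_fun setT
    (fun x => (d_psi_vag psi f (empirical n x) (marginal P 0))%:E).
  by apply/measurable_EFinP; exact: (measurable_d_psi_vag psi_lln f_lln).
(* Markov's inequality for the absolute value of the distance, whose event [delta <= |d|] contains
   the one in question. *)
apply: le_trans (le_integral_comp_abse P measurableT (f := id) _ _ _ mdE
  delta_gt0) => //.
rewrite lee_pmul2l//; apply: le_measure; rewrite ?inE//.
- rewrite -[X in measurable (_ `&` X)]/[set x | (delta <=
    `|d_psi_vag psi f (empirical n x) (marginal P 0)|)%R].
  apply: measurable_fun_le => //; apply: measurableT_comp => //.
  exact: (measurable_d_psi_vag psi_lln f_lln).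
- by move=> x /= dx; split=> //; rewrite lee_fin (le_trans dx)// ler_norm.
Qed.
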